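(* Let $\mu$ be a random finite Borel measure on $\mathbb{R}^d$. (1) Suppose that, for some $\theta\in(0,1]$ and $s>0$, for all $z\in\mathbb{R}^d$, \[ \mathbb{E}\left(|\widehat\mu(z)|^{2/\theta}\right)\lesssim|z|^{-s/\theta}. \] Then $\dim_{\mathrm F}^{\theta}\mu\geq s$ almost surely. (2) In particular, if $\widehat\mu$ is Hölder almost surely and for a sequence of $k\in\mathbb{N}$ tending to infinity it holds that for all $z\in\mathbb{R}^d$ \[ \mathbb{E}\left(|\widehat\mu(z)|^{2k}\right)\lesssim|z|^{-sk}, \] then $\dim_{\mathrm F}\mu\geq s$ almost surely. (3) Further, if $\widehat\mu$ is $\alpha$-Hölder almost surely and there exist $\varepsilon>0$ and $\theta\in(0,1)$ such that, for all $z\in\mathbb{R}^d$, \[ \mathbb{E}\left(|\widehat\mu(z)|^{2/\theta}\right)\lesssim|z|^{-(d+\varepsilon)}, \] then \[ \dim_{\mathrm F}\mu\geq\frac{2\alpha\varepsilon\theta}{2\alpha+d\theta}>0 \] almost surely.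
   Context: $A(z)\lesssim B(z)$ means there is a constant $c>0$, independent of $z$, with $A(z)\leq cB(z)$; in (2) the constant may depend on $k$. At $z=0$ negative powers of $|z|$ are read as $+\infty$. A function $g$ on $\mathbb{R}^d$ is $\alpha$-Hölder ($\alpha\in(0,1]$) if there is $C>0$ with $|g(x)-g(y)|\leq C|x-y|^\alpha$ for all $x,y$, and Hölder if it is $\alpha$-Hölder for some $\alpha\in(0,1]$; in (2) the exponent and in (2), (3) the constant $C$ may be random. For a finite Borel measure $\mu$ on $\mathbb{R}^d$ write $\widehat\mu(z)=\int e^{-2\pi i z\cdot x}\,d\mu(x)$. For $s\geq 0$ and $\theta\in(0,1]$ let $\mathcal{J}_{s,\theta}(\mu)=\left(\int_{\mathbb{R}^d}|\widehat\mu(z)|^{2/\theta}|z|^{s/\theta-d}\,dz\right)^{\theta}$, and let $\mathcal{J}_{s,0}(\mu)=\sup_{z\in\mathbb{R}^d}|\widehat\mu(z)|^2|z|^s$. The Fourier spectrum of $\mu$ at $\theta\in[0,1]$ is $\dim_{\mathrm F}^{\theta}\mu=\sup\{s\geq 0:\mathcal{J}_{s,\theta}(\mu)<\infty\}\in[0,\infty]$, with $\sup\emptyset=0$, and $\dim_{\mathrm F}\mu=\dim_{\mathrm F}^0\mu$ is the Fourier dimension. *)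

(* Defs.v *)
From HB Require Import structures.
From mathcomp Require Import all_boot all_order all_algebra.
From mathcomp Require Import complex.
From mathcomp Require Import all_classical all_reals all_analysis.

Set Implicit Arguments.
Unset Strict Implicit.
Unset Printing Implicit Defensive.

Import Order.TTheory GRing.Theory Num.Theory.
Import numFieldNormedType.Exports.

Local Open Scope classical_set_scope.
Local Open Scope ring_scope.

(* R^d is represented by tuples because they carry a measurable structure in
   the library: the sigma-algebra generated by the coordinate maps, i.e. the
   Borel sigma-algebra of R^d. *)
Notation euclid R d := (d.-tuple (measurableTypeR R)).

Section lebesgue_tuple.
Context {R : realType}.

Section step.
Variables (n : nat) (m : {sigma_finite_measure set (euclid R n) -> \bar R}).

Definition tuple_cons (x : measurableTypeR R * euclid R n) : euclid R n.+1 :=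
  [tuple of x.1 :: x.2].

Lemma measurable_tuple_cons : measurable_fun setT tuple_cons.
Proof. exact: measurable_cons. Qed.

Definition lebesgue_tupleS : set (euclid R n.+1) -> \bar R :=
  pushforward (@lebesgue_measure R \x m)%E tuple_cons.

Let mcons := measurable_tuple_cons.

Let lebesgue_tupleS0 : lebesgue_tupleS set0 = 0%E.
Proof. by rewrite /lebesgue_tupleS /pushforward preimage_set0 measure0. Qed.

Let lebesgue_tupleS_ge0 A : (0 <= lebesgue_tupleS A)%E.
Proof. exact: measure_ge0. Qed.

Let lebesgue_tupleS_sigma_additive : semi_sigma_additive lebesgue_tupleS.
Proof. exact: measure_semi_sigma_additive. Qed.

HB.instance Definition _ := isMeasure.Build _ _ _ lebesgue_tupleS
  lebesgue_tupleS0 lebesgue_tupleS_ge0 lebesgue_tupleS_sigma_additive.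

Let lebesgue_tupleS_sigma_finite : sigma_finite setT lebesgue_tupleS.
Proof.
have /sigma_finiteP[F [FT ndF Foo]] := sigma_finiteT (@lebesgue_measure R).
have /sigma_finiteP[G [GT ndG Goo]] := sigma_finiteT m.
pose u (t : euclid R n.+1) : measurableTypeR R * euclid R n :=
  (thead t, [tuple of behead t]).
have uK x : u (tuple_cons x) = x.
  by case: x => a b; rewrite /u theadE; congr pair; exact: val_inj.
have mu : measurable_fun setT u.
  by apply/measurable_fun_pair; [exact: measurable_tnth|exact: measurable_behead].
exists (fun k => u @^-1` (F k `*` G k)).
  rewrite -preimage_bigcup; apply/esym/seteqP; split => // t _.
  have [i _ Fi] : (\bigcup_k F k) (u t).1 by rewrite -FT.
  have [j _ Gj] : (\bigcup_k G k) (u t).2 by rewrite -GT.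
  exists (maxn i j) => //; split.
  - by move: Fi; exact/subsetPset/ndF/leq_maxl.
  - by move: Gj; exact/subsetPset/ndG/leq_maxr.
move=> k; have [mF Fk] := Foo k; have [mG Gk] := Goo k; split.
  by rewrite -[X in measurable X]setTI; apply: mu => //; exact: measurableX.
rewrite /lebesgue_tupleS /pushforward -comp_preimage.
rewrite (_ : u \o tuple_cons = id); last exact/funext.
by rewrite preimage_id product_measure1E// lte_mul_pinfty// ge0_fin_numE.
Qed.

HB.instance Definition _ := @Measure_isSigmaFinite.Build _ _ _
  lebesgue_tupleS lebesgue_tupleS_sigma_finite.

End step.

(* Lebesgue measure on R^n: on R^0 it is the unit mass, and on R^(n+1) it is the
   product of the Lebesgue measures of R and R^n. *)
Fixpoint lebesgue_tuple (n : nat) :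
    {sigma_finite_measure set (euclid R n) -> \bar R} :=
  match n with
  | 0 => \d_([tuple] : euclid R 0)
  | n'.+1 => lebesgue_tupleS (lebesgue_tuple n')
  end.

End lebesgue_tuple.

Definition lesssim (R : realType) (T : Type) (A B : T -> \bar R) : Prop :=
  exists2 c : R, 0 < c & forall z, (A z <= c%:E * B z)%E.

Section fourier.
Context {R : realType} {d : nat}.
Implicit Types (x z : euclid R d) (mu : {measure set (euclid R d) -> \bar R}).

Definition dotp z x : R := \sum_(i < d) (tnth z i : R) * (tnth x i : R).

Definition enorm z : R := Num.sqrt (dotp z z).

Definition edist x y : R :=
  Num.sqrt (\sum_(i < d) ((tnth x i : R) - (tnth y i : R)) ^+ 2).

(* e^(i t) *)
Definition expi (t : R) : R[i] := Complex (cos t) (sin t).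

Definition cintegral mu (f : euclid R d -> R[i]) : R[i] :=
  Complex (\int[mu]_x complex.Re (f x)) (\int[mu]_x complex.Im (f x)).

Definition fourier mu z : R[i] :=
  cintegral mu (fun x => expi (- (2 * pi * dotp z x))).

Definition fourier_abs mu z : R := Normc.normc (fourier mu z).

(* a^r for a >= 0, with negative powers of 0 read as +oo (the library's powR
   gives 0 for them); 0^0 = 1. *)
Definition powRoo (a r : R) : \bar R :=
  if (a == 0) && (r < 0) then +oo%E else (a `^ r)%:E.

Definition fourier_energy (s theta : R) mu : \bar R :=
  if theta == 0 then
    ereal_sup [set ((fourier_abs mu z ^+ 2)%:E * powRoo (enorm z) s)%E
              | z in [set: euclid R d]]
  else
    ((\int[lebesgue_tuple d]_z
        ((fourier_abs mu z `^ (2 / theta))%:E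
         * powRoo (enorm z) (s / theta - d%:R))) `^ theta)%E.

(* The maximum with 0 implements the convention that the supremum of the empty
   set is 0. *)
Definition fourier_spectrum (theta : R) mu : \bar R :=
  Order.max 0%E (ereal_sup [set s%:E
                    | s in [set s : R | 0 <= s /\
                              (fourier_energy s theta mu < +oo)%E]]).

Definition fourier_dim mu : \bar R := fourier_spectrum 0 mu.

Definition alpha_holder (alpha : R) (g : euclid R d -> R[i]) : Prop :=
  exists2 C : R, 0 < C &
    forall x y, Normc.normc (g x - g y) <= C * edist x y `^ alpha.

Definition is_holder (g : euclid R d -> R[i]) : Prop :=
  exists2 alpha : R, 0 < alpha <= 1 & alpha_holder alpha g.

End fourier.

(* Main.v *)
(* Tonelli's theorem turns the moment bound into the almost sure finiteness of
   the integrals of |mu^|^p |z|^q over |z| >= 1 for all q < r - d, where -r is the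
   exponent of the moment bound; over |z| < 1 the crude bound |mu^| <= 2 mu(R^d)
   suffices. This gives (1). For (2) and (3), if mu^ is alpha-Holder and
   |mu^(z)| = t, then |mu^| >= t/2 on a cube of side comparable to t^(1/alpha)
   at z, so finiteness of the integral forces
   t^(p + d/alpha) |z|^q to be bounded, that is, polynomial decay of mu^. In (3)
   one takes p = 2/theta and q close to epsilon, in (2) p = 2k and q close to
   s k - d with k tending to infinity. *)

Require Import Defs.
From HB Require Import structures.
From mathcomp Require Import all_boot all_order all_algebra.
From mathcomp Require Import complex.
From mathcomp Require Import all_classical all_reals all_analysis.
From mathcomp Require Import measurable_realfun.
From mathcomp Require Import ring lra.

Set Implicit Arguments.
Unset Strict Implicit.
Unset Printing Implicit Defensive.

Import Order.TTheory GRing.Theory Num.Theory.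
Import numFieldNormedType.Exports.

Local Open Scope classical_set_scope.
Local Open Scope ring_scope.

(** * Real powers, and powers that are infinite at zero *)

Lemma powR_exprAC (R : realType) (a q : R) k : 0 <= a ->
  (a ^+ k) `^ q = (a `^ q) ^+ k.
Proof.
by move=> a0; rewrite -(powR_mulrn k a0) powRAC powR_mulrn ?powR_ge0.
Qed.

Lemma powR_lt1 (R : realType) (a q : R) : 1 < a -> q < 0 -> a `^ q < 1.
Proof.
move=> a1 q0; rewrite /powR gt_eqF ?(lt_trans _ a1)// -expR0 ltr_expR.
by rewrite nmulr_rlt0// ln_gt0.
Qed.

Lemma powR_div (R : realType) (a b r : R) : 0 <= a -> 0 <= b ->
  (a / b) `^ r = a `^ r / b `^ r.
Proof.
move=> a0 b0; rewrite powRM ?invr_ge0// -(powR_inv1 b0) powRAC.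
by rewrite powR_inv1 ?powR_ge0.
Qed.

Lemma powRoo_gt0 (R : realType) (a r : R) : 0 < a -> powRoo a r = (a `^ r)%:E.
Proof. by move=> a0; rewrite /powRoo gt_eqF. Qed.

Lemma powRoo_ge0 (R : realType) (a r : R) : (0 <= powRoo a r)%E.
Proof. by rewrite /powRoo; case: ifP => // _; rewrite lee_fin powR_ge0. Qed.

(** * The Euclidean norm and distance on tuples *)

Section norm.
Context {R : realType} {n : nat}.
Implicit Types x y z : euclid R n.

Lemma dotp_self x : dotp x x = \sum_(i < n) (tnth x i : R) ^+ 2.
Proof. by apply: eq_bigr => i _; rewrite expr2. Qed.

Lemma enorm_ge0 x : 0 <= enorm x.
Proof. exact: sqrtr_ge0. Qed.

Lemma tnth_le_enorm x i : `|tnth x i : R| <= enorm x.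
Proof.
rewrite -sqrtr_sqr /enorm ler_wsqrtr// dotp_self (bigD1 i)//= lerDl.
by rewrite sumr_ge0// => j _; exact: sqr_ge0.
Qed.

Lemma ler_enorm x y : (forall i, `|tnth x i : R| <= `|tnth y i : R|) ->
  enorm x <= enorm y.
Proof.
move=> xy; rewrite /enorm ler_wsqrtr// !dotp_self ler_sum// => i _.
by rewrite -(real_normK (num_real (tnth x i : R)))
  -(real_normK (num_real (tnth y i : R))) ler_pXn2r// ?nnegrE.
Qed.

(** The factor [n], cruder than its square root, suffices because the side of a cube only matters up
    to a constant. *)
Lemma edist_le x y (h : R) : 0 <= h ->
  (forall i, `|(tnth x i : R) - (tnth y i : R)| <= h) ->
  Defs.edist x y <= n%:R * h.
Proof.
move=> h0 xyh; have nh0 : 0 <= n%:R * h by rewrite mulr_ge0.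
rewrite /Defs.edist -[leRHS]ger0_norm// -sqrtr_sqr ler_wsqrtr//.
apply: (@le_trans _ _ (\sum_(i < n) h ^+ 2)).
  apply: ler_sum => i _; rewrite -(real_normK (num_real (_ - _))).
  by rewrite ler_pXn2r ?nnegrE.
rewrite sumr_const card_ord -(mulr_natl (h ^+ 2)) exprMn ler_wpM2r ?sqr_ge0//.
by rewrite -natrX ler_nat; case: (n) => // k; rewrite expnS expn1 leq_pmulr.
Qed.

Lemma measurable_enorm : measurable_fun [set: euclid R n] (@enorm R n).
Proof.
apply: (@measurableT_comp _ _ _ _ _ _ (@Num.sqrt R) _ (fun x => dotp x x)).
  apply: continuous_measurable_fun; exact: sqrt_continuous.
apply: measurable_sum => i.
by apply: measurable_funM; exact: measurable_tnth.
Qed.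

End norm.

(** * Axis-parallel cubes and their volume *)

Section cube.
Context {R : realType}.

Definition cube n (a : 'I_n -> R) (h : R) : set (euclid R n) :=
  [set x | forall i, a i <= (tnth x i : R) <= a i + h].

Lemma measurable_cube n (a : 'I_n -> R) h : measurable (cube a h).
Proof.
rewrite (_ : cube a h = \bigcap_i ((@tnth n (measurableTypeR R))^~ i @^-1`
    `[a i, a i + h])).
  apply: fin_bigcap_measurable => [|i _]; first exact: finite_finset.
  by rewrite -[X in measurable X]setTI; exact: measurable_tnth.
apply/seteqP; split=> x /=.
  by move=> xa i _ /=; rewrite in_itv/= xa.
by move=> xa i; have := xa i I; rewrite /= in_itv.
Qed.

(** Induction on the dimension: splitting off the first coordinate turns the cube into an interval
    times a cube of one dimension less. *)
Lemma lebesgue_cube n (a : 'I_n -> R) (h : R) : 0 <= h ->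
  lebesgue_tuple n (cube a h) = (h ^+ n)%:E.
Proof.
move=> h0; elim: n a => [|n ih] a.
  by rewrite /= /dirac indicE mem_set//; case.
rewrite [LHS]/= /lebesgue_tupleS /pushforward.
rewrite (_ : tuple_cons (n:=n) @^-1` cube a h =
   `[a ord0, a ord0 + h] `*` cube (a \o lift ord0) h); last first.
  apply/seteqP; split=> [[u v] /= uv|[u v] /= []].
    split; first by have := uv ord0; rewrite tnth0 in_itv.
    by move=> i; have := uv (lift ord0 i); rewrite tnthS.
  rewrite in_itv/= => ua va i; case: (unliftP ord0 i) => [j|] ->.
    by rewrite tnthS; exact: va.
  by rewrite tnth0.
rewrite product_measure1E//; last exact: measurable_cube.
have itvh b : lebesgue_measure (`[b, b + h] : set R) = h%:E.
  rewrite lebesgue_measure_itv/= lte_fin ltrDl -EFinD addrAC subrr add0r.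
  by case: ltP => // h0'; rewrite (@le_anti _ _ h 0) ?h0 ?h0'.
by rewrite [X in (_ * X)%E]ih [X in (X * _)%E]itvh exprS.
Qed.

End cube.

(** * Geometric series and dyadic scales *)

Lemma nneseries_geometric_lty (R : realType) (K kappa : R) :
  0 <= K -> 0 <= kappa < 1 -> (\sum_(k <oo) (K * kappa ^+ k)%:E < +oo)%E.
Proof.
move=> K0 /andP[k0 k1].
apply: (@le_lt_trans _ _ (K / (1 - kappa))%:E); last exact: ltry.
apply: lime_le.
  by apply: is_cvg_nneseries => k _ _; rewrite lee_fin mulr_ge0// exprn_ge0.
apply: nearW => m; rewrite sumEFin lee_fin.
have k_neq1 : kappa != 1 by rewrite lt_eqF.
have := geometric_seriesE K k_neq1.
move=> /(congr1 (fun u => u m)) /=; rewrite seriesEnat /= => ->.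
rewrite ler_wpM2r ?invr_ge0 ?subr_ge0 ?(ltW k1)// ler_piMr// gerBl.
exact: exprn_ge0.
Qed.

(** The witness is the binary logarithm, rounded down, of the integer part of [t]. *)
Lemma dyadic_bounds (R : realType) (t : R) : 1 <= t ->
  exists k, 2 ^+ k <= t < 2 ^+ k.+1.
Proof.
move=> t1; have t0 : 0 <= t by exact: le_trans t1.
have /andP[tm tM] := truncn_itv t0.
have m0 : (0 < Num.truncn t)%N by rewrite truncn_gt0.
exists (trunc_log 2 (Num.truncn t)).
have /andP[lm lM] := trunc_log_bounds (isT : 1 < 2)%N m0.
rewrite -!natrX (le_trans _ tm) ?ler_nat//=.
by rewrite (lt_le_trans tM)// ler_nat.
Qed.

(** * Integrability of powers of the norm at infinity and at the origin *)

Section power_integrals.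
Context {R : realType} {n : nat} (n_gt0 : (0 < n)%N).
Local Notation E := (euclid R n).

Definition centered_cube (r : R) : set E := cube (fun=> - r) (2 * r).

Lemma centered_cubeP (x : E) r : enorm x <= r -> centered_cube r x.
Proof.
move=> xr i; have := le_trans (tnth_le_enorm x i) xr.
rewrite ler_norml => /andP[-> xi] /=; lra.
Qed.

Lemma measurable_enorm_eq0 : measurable [set x : E | enorm x = 0].
Proof.
rewrite (_ : [set _ | _] = enorm @^-1` [set 0])//.
by rewrite -[X in measurable X]setTI; exact: measurable_enorm.
Qed.

(** The set lies in the degenerate cube of side 0, whose volume [0 ^+ n] vanishes as [n > 0]. *)
Lemma lebesgue_enorm_eq0 : lebesgue_tuple n [set x : E | enorm x = 0] = 0%E.
Proof.
apply/eqP; rewrite -measure_le0.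
apply: (@le_trans _ _ (lebesgue_tuple n (centered_cube 0))).
  apply: le_measure; rewrite ?inE; first exact: measurable_enorm_eq0.
    exact: measurable_cube.
  by move=> x /= x0; apply: centered_cubeP; rewrite x0.
by rewrite lebesgue_cube ?mulr0// expr0n gtn_eqF.
Qed.

(* Excluding [enorm x = 0] allows an infinite value of [f] at the origin. *)
Lemma integral_cover_lty (f : E -> \bar R) (rho w : nat -> R) (K kappa : R) :
  measurable_fun setT f -> (forall x, 0 <= f x)%E ->
  (forall k, 0 <= rho k) -> (forall k, 0 <= w k) -> 0 <= kappa < 1 ->
  (forall k, w k * (2 * rho k) ^+ n <= K * kappa ^+ k) ->
  (forall x, enorm x != 0 ->
    f x = 0%E \/ exists k, enorm x <= rho k /\ (f x <= (w k)%:E)%E) ->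
  (\int[lebesgue_tuple n]_x f x < +oo)%E.
Proof.
move=> mf f0 rho0 w0 kappa1 wK fw.
have K0 : 0 <= K.
  have := wK 0; rewrite expr0 mulr1; apply: le_trans.
  by rewrite mulr_ge0// exprn_ge0// mulr_ge0.
(* Away from the origin, wherever [f] is nonzero a single term [g k] already dominates it, so the
   integral of [f] is at most the sum of the [w k] times the cube volumes. *)
pose g k (x : E) := ((w k)%:E * (\1_(centered_cube (rho k)) x)%:E)%E.
have g0 k x : (0 <= g k x)%E by rewrite mule_ge0 ?lee_fin.
have sg0 x : (0 <= \sum_(k <oo) g k x)%E.
  by apply: nneseries_ge0 => k _ _; exact: g0.
have mg k : measurable_fun setT (g k).
  apply: measurable_funeM; apply/measurable_EFinP.
  apply: measurable_indic; exact: measurable_cube.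
have fg : (\int[lebesgue_tuple n]_x f x <=
    \int[lebesgue_tuple n]_x (\sum_(k <oo) g k x))%E.
  apply: ae_ge0_le_integral => //.
  - by apply: ge0_emeasurable_sum => // k x _ _; exact: g0.
  exists [set x : E | enorm x = 0]; split.
  - exact: measurable_enorm_eq0.
  - exact: lebesgue_enorm_eq0.
  move=> x /=; apply: contra_notP => /eqP x0 _.
  have [->//|[k [xk fk]]] := fw x x0.
  rewrite (le_trans fk)// (@nneseriesD1 _ _ k)// /g.
  rewrite indicE mem_set ?mule1; last exact: centered_cubeP.
  by rewrite leeDl//; apply: nneseries_ge0 => j _ _; exact: g0.
rewrite (le_lt_trans fg)// integral_nneseries//.
apply: le_lt_trans (nneseries_geometric_lty K0 kappa1).
apply: lee_nneseries => [k _ _|k _]; first exact: integral_ge0.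
rewrite ge0_integralZl ?lee_fin//; last first.
  by apply/measurable_EFinP; apply: measurable_indic; exact: measurable_cube.
rewrite integral_indic//; last exact: measurable_cube.
by rewrite setIT [X in (_ * X)%E]lebesgue_cube ?mulr_ge0// -EFinM lee_fin.
Qed.

(** The power of the norm is cut at radius 1: this outer piece is always finite, so it can be
    real-valued, while the inner piece may be infinite at the origin. *)
Definition tail_weight (q : R) (z : E) : R :=
  if 1 <= enorm z then enorm z `^ q else 0.

Definition core_weight (q : R) (z : E) : \bar R :=
  if 1 <= enorm z then 0%E else powRoo (enorm z) q.

Lemma powRoo_split q z :
  powRoo (enorm z) q = ((tail_weight q z)%:E + core_weight q z)%E.
Proof.
rewrite /tail_weight /core_weight; case: ifPn => z1; last by rewrite add0e.
by rewrite adde0 powRoo_gt0// (lt_le_trans _ z1).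
Qed.

Lemma tail_weight_ge0 q z : 0 <= tail_weight q z.
Proof. by rewrite /tail_weight; case: ifP => // _; exact: powR_ge0. Qed.

Lemma core_weight_ge0 q z : (0 <= core_weight q z)%E.
Proof. by rewrite /core_weight; case: ifP => // _; exact: powRoo_ge0. Qed.

Lemma measurable_tail_weight q : measurable_fun setT (tail_weight q).
Proof.
apply: measurable_fun_ifT => //.
  by apply: measurable_fun_ler => //; exact: measurable_enorm.
by apply: (measurableT_comp (measurable_powR q)); exact: measurable_enorm.
Qed.

Lemma measurable_core_weight q : measurable_fun setT (core_weight q).
Proof.
apply: measurable_fun_ifT => //.
  by apply: measurable_fun_ler => //; exact: measurable_enorm.
apply: measurable_fun_ifT => //.
  apply: measurable_and => //.
  by apply: measurable_fun_eqr => //; exact: measurable_enorm.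
apply/measurable_EFinP.
by apply: (measurableT_comp (measurable_powR q)); exact: measurable_enorm.
Qed.

(** Dyadic shells with norm between [2 ^+ k] and [2 ^+ k.+1]: as [q < 0] the weight is largest at
    the inner radius, and multiplied by the volume of a cube around the shell it gives a geometric
    sequence whose ratio, 2 to the power [q + n], is below 1. *)
Lemma integral_tail_weight_lty q : q < - n%:R ->
  (\int[lebesgue_tuple n]_z (tail_weight q z)%:E < +oo)%E.
Proof.
move=> qn; have q0 : q < 0 by rewrite (lt_le_trans qn)// oppr_le0.
apply: (@integral_cover_lty _ (fun k => 2 ^+ k.+1) (fun k => (2 ^+ k) `^ q)
    (4 ^+ n) (2 `^ (q + n%:R))).
- by apply/measurable_EFinP; exact: measurable_tail_weight.
- by move=> x; rewrite lee_fin tail_weight_ge0.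
- by move=> k; rewrite exprn_ge0.
- by move=> k; rewrite powR_ge0.
- by rewrite powR_ge0 powR_lt1 ?ltr1n// -ltrBrDr sub0r.
- move=> k; rewrite powR_exprAC// powRD; last by rewrite pnatr_eq0 implybT.
  rewrite powR_mulrn// (_ : 2 * 2 ^+ k.+1 = 4 * 2 ^+ k); last by rewrite exprS; ring.
  by rewrite !exprMn (exprAC _ k n) mulrCA.
move=> x _; rewrite /tail_weight; case: ifPn => x1; last by left.
right; have [k /andP[kx xk]] := dyadic_bounds x1.
exists k; split; first exact: ltW.
rewrite lee_fin -(opprK q) !(powRN _ (- q)) lef_pV2 ?posrE ?powR_gt0 ?exprn_gt0//.
  by rewrite ge0_ler_powR ?nnegrE ?exprn_ge0 ?enorm_ge0// oppr_ge0 ltW.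
by rewrite (lt_le_trans _ x1).
Qed.

(** Dyadic shells shrinking to the origin, with norm between [2 ^- k.+1] and [2 ^- k]; the volumes
    now decay faster than the weights grow. *)
Lemma integral_core_weight_lty q : - n%:R < q ->
  (\int[lebesgue_tuple n]_z core_weight q z < +oo)%E.
Proof.
(* Lowering the exponent to [b <= 0] only enlarges powers of a norm below 1, and makes the weight on
   a shell largest at its inner radius. *)
move=> nq; pose b := Num.min q 0.
have b0 : b <= 0 by rewrite ge_min lexx orbT.
have nb : - n%:R < b by rewrite lt_min nq/= oppr_lt0 ltr0n.
have bq : b <= q by rewrite ge_min lexx.
apply: (@integral_cover_lty _ (fun k => 2 ^- k) (fun k => (2 ^+ k.+1) `^ (- b))
    (2 `^ (- b) * 2 ^+ n) (2 `^ (- (b + n%:R)))).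
- exact: measurable_core_weight.
- exact: core_weight_ge0.
- by move=> k; rewrite invr_ge0 exprn_ge0.
- by move=> k; rewrite powR_ge0.
- by rewrite powR_ge0 powR_lt1 ?ltr1n// oppr_lt0 -ltrBlDr sub0r.
- move=> k; rewrite opprD powRD; last by rewrite pnatr_eq0 implybT.
  rewrite powR_exprAC// powR_invn// exprS exprMn exprMn -!exprVn.
  by rewrite (exprAC _ k n) !mulrA [X in X * _ <= _]mulrAC.
move=> x x0; rewrite /core_weight; case: ifPn => [|x1]; first by left.
right; have x_gt0 : 0 < enorm x by rewrite lt_def x0 enorm_ge0.
have x_lt1 : enorm x < 1 by rewrite ltNge.
have /dyadic_bounds[k /andP[kx xk]] : 1 <= (enorm x)^-1.
  by rewrite invf_ge1// ltW.
exists k; split; first by rewrite -[leLHS]invrK lef_pV2 ?posrE ?exprn_gt0 ?invr_gt0.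
rewrite powRoo_gt0// lee_fin (@le_trans _ _ (enorm x `^ b))//.
  by rewrite ger_powR// x_gt0 ltW.
rewrite -[in leLHS](opprK b) powRN -powR_inv1 ?powR_ge0// powRAC.
rewrite powR_inv1 ?enorm_ge0//.
by rewrite ge0_ler_powR ?nnegrE ?invr_ge0 ?enorm_ge0 ?exprn_ge0 ?oppr_ge0// ltW.
Qed.

End power_integrals.

(** * Integrals against a kernel, measurable jointly with a further parameter *)

Section kernel_fst.
Context {dX dY dZ : measure_display} {X : measurableType dX}
  {Y : measurableType dY} {Z : measurableType dZ} {R : realType}.

(* A kernel from [X] seen as a kernel from [X * Y], so that integrals depending
   on a further parameter in [Y] are jointly measurable in both parameters. *)
Definition kernel_fst (k : X -> {measure set Z -> \bar R}) (p : X * Y) :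
  {measure set Z -> \bar R} := k p.1.

Section kernel.
Variable k : R.-ker X ~> Z.

Let measurable_kernel_fst U : measurable U ->
  measurable_fun [set: X * Y] (kernel_fst k ^~ U).
Proof.
move=> mU; apply: (measurableT_comp (measurable_kernel k U mU)).
exact: measurable_fst.
Qed.

HB.instance Definition _ :=
  isKernel.Build _ _ (X * Y)%type Z R (kernel_fst k) measurable_kernel_fst.

End kernel.

Section sfinite_kernel.
Variable k : R.-sfker X ~> Z.

Let sfinite_kernel_fst : exists2 s : (R.-ker (X * Y)%type ~> Z)^nat,
  forall n, measure_fam_uub (s n) &
  forall p U, measurable U -> kernel_fst k p U = mseries (s ^~ p) 0 U.
Proof.
have [s ks] := sfinite_kernel k; exists (fun n => kernel_fst (s n)).
  by move=> n; have [r sr] := measure_uub (s n); exists r => p; exact: sr.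
by move=> p U mU; rewrite /kernel_fst ks.
Qed.

HB.instance Definition _ := isSFiniteKernel_subdef.Build _ _ (X * Y)%type Z R
  (kernel_fst k) sfinite_kernel_fst.

End sfinite_kernel.

(** Measurability of kernel integrals is available for nonnegative integrands, so the positive and
    negative parts are treated separately and subtracted. *)
Lemma measurable_Rintegral_kernel_fst (k : R.-sfker X ~> Z)
    (f : (X * Y) * Z -> R) : measurable_fun setT f ->
  measurable_fun setT (fun p : X * Y => (\int[k p.1]_x f (p, x))%R).
Proof.
move=> mf; apply: (measurableT_comp (fine_measurable measurableT)).
have posE p : ((fun x => (f (p, x))%:E)^\+ = (fun x => (EFin \o f)^\+ (p, x)))%E.
  by apply/funext => x; rewrite !funeposE.
have negE p : ((fun x => (f (p, x))%:E)^\- = (fun x => (EFin \o f)^\- (p, x)))%E.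
  by apply/funext => x; rewrite !funenegE.
under eq_fun do rewrite integralE posE negE.
have mEf : measurable_fun setT (EFin \o f) by apply/measurable_EFinP.
have mint (g : (X * Y) * Z -> \bar R) : (forall t, 0 <= g t)%E ->
    measurable_fun setT g ->
    measurable_fun setT (fun p : X * Y => \int[k p.1]_x g (p, x))%E.
  exact: (measurable_fun_integral_sfinite_kernel g (kernel_fst k)).
apply: emeasurable_funB.
  exact: (mint (EFin \o f)^\+%E (funepos_ge0 _) (measurable_funepos mEf)).
exact: (mint (EFin \o f)^\-%E (funeneg_ge0 _) (measurable_funeneg mEf)).
Qed.

End kernel_fst.

(** * Measurability and size of the Fourier transform *)

Section fourier_transform.
Context {R : realType} {d : nat}.
Local Notation E := (euclid R d).

Lemma measurable_dotp : measurable_fun setT (fun p : E * E => dotp p.1 p.2).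
Proof.
apply: measurable_sum => i; apply: measurable_funM.
  exact: (measurableT_comp (measurable_tnth i) measurable_fst).
exact: (measurableT_comp (measurable_tnth i) measurable_snd).
Qed.

Lemma measurable_phase : measurable_fun setT
  (fun p : E * E => - (2 * pi * dotp p.1 p.2) : R).
Proof.
apply: measurableT_comp => //; apply: measurable_funM => //.
exact: measurable_dotp.
Qed.

Lemma measurable_cos : measurable_fun setT (@cos R).
Proof. by apply: continuous_measurable_fun; exact: continuous_cos. Qed.

Lemma measurable_sin : measurable_fun setT (@sin R).
Proof. by apply: continuous_measurable_fun; exact: continuous_sin. Qed.

(** Joint measurability in the sample point and the frequency is what Tonelli's theorem needs. The
    modulus is the square root of the squared cosine integral plus the squared sine integral. *)
Lemma measurable_fourier_abs (disp : measure_display)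
    (Omega : measurableType disp) (mu : R.-sfker Omega ~> E) :
  measurable_fun setT (fun p : Omega * E => fourier_abs (mu p.1) p.2).
Proof.
have mph : measurable_fun setT
    (fun t : (Omega * E) * E => - (2 * pi * dotp t.1.2 t.2) : R).
  apply: (@measurableT_comp _ _ _ _ _ _ _ _
    (fun t : (Omega * E) * E => (t.1.2, t.2)) measurable_phase).
  apply/measurable_fun_pair => //=.
  exact: (measurableT_comp measurable_snd measurable_fst).
apply: (@measurableT_comp _ _ _ _ _ _ (@Num.sqrt R) _
  (fun p : Omega * E => (\int[mu p.1]_x cos (- (2 * pi * dotp p.2 x))) ^+ 2 +
    (\int[mu p.1]_x sin (- (2 * pi * dotp p.2 x))) ^+ 2)).
  by apply: continuous_measurable_fun; exact: sqrt_continuous.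
apply: measurable_funD; apply: measurable_funX.
  exact: (measurable_Rintegral_kernel_fst mu (measurableT_comp measurable_cos mph)).
exact: (measurable_Rintegral_kernel_fst mu (measurableT_comp measurable_sin mph)).
Qed.

Lemma normr_Rintegral_le_mass (disp : measure_display)
    (T : measurableType disp) (m : {measure set T -> \bar R}) (f : T -> R) :
  m setT \is a fin_num -> measurable_fun setT f -> (forall x, `|f x| <= 1) ->
  `|\int[m]_x f x| <= fine (m setT).
Proof.
move=> mfin mf f1.
have If : (\int[m]_x `|(f x)%:E| <= m setT)%E.
  rewrite -[leRHS]mul1e -integral_cst//; apply: ge0_le_integral => //.
    by apply/measurable_EFinP; exact: measurableT_comp.
  by move=> x _; rewrite lee_fin.
have Ifin : (\int[m]_x (f x)%:E)%E \is a fin_num.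
  rewrite fin_num_abs; apply: le_lt_trans (le_abse_integral _ _ _) _ => //.
    exact/measurable_EFinP.
  by rewrite (le_lt_trans If)// ltey_eq mfin.
rewrite /Rintegral -[leLHS]/(fine `|(fine (\int[m]_x (f x)%:E)%E)%:E|%E) fineK//.
rewrite fine_le ?abse_fin_num//; apply: le_trans If.
by apply: le_abse_integral => //; exact/measurable_EFinP.
Qed.

Lemma fourier_abs_ge0 (m : {measure set E -> \bar R}) z : 0 <= fourier_abs m z.
Proof. exact: sqrtr_ge0. Qed.

(** Bounding the real and imaginary parts separately by the mass costs a factor of at most the
    square root of 2, rounded up to 2. *)
Lemma fourier_abs_le_mass (m : {measure set E -> \bar R}) z :
  m setT \is a fin_num -> fourier_abs m z <= 2 * fine (m setT).
Proof.
move=> mfin; set M := fine (m setT).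
have M0 : 0 <= M by rewrite fine_ge0.
have mph : measurable_fun setT (fun x : E => - (2 * pi * dotp z x) : R).
  apply: (@measurableT_comp _ _ _ _ _ _ _ _ (fun x : E => (z, x))
    measurable_phase).
  exact: measurable_fun_pair.
have cM : `|\int[m]_x cos (- (2 * pi * dotp z x))| <= M.
  apply: normr_Rintegral_le_mass => // [|x].
    exact: (measurableT_comp measurable_cos).
  by rewrite ler_norml cos_geN1 cos_le1.
have sM : `|\int[m]_x sin (- (2 * pi * dotp z x))| <= M.
  apply: normr_Rintegral_le_mass => // [|x].
    exact: (measurableT_comp measurable_sin).
  by rewrite ler_norml sin_geN1 sin_le1.
have sq (a : R) : `|a| <= M -> a ^+ 2 <= M ^+ 2.
  by move=> aM; rewrite -(real_normK (num_real a)) ler_pXn2r ?nnegrE.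
rewrite -[leRHS]ger0_norm ?mulr_ge0// -sqrtr_sqr ler_wsqrtr//.
rewrite exprMn (le_trans (lerD (sq _ cM) (sq _ sM)))//.
have := sqr_ge0 M; lra.
Qed.

Lemma fourier_absB_le (m : {measure set E -> \bar R}) x y :
  fourier_abs m x - fourier_abs m y <= Normc.normc (fourier m x - fourier m y).
Proof.
rewrite lerBlDr /fourier_abs.
by rewrite -[in leLHS](subrK (fourier m y) (fourier m x)) le_normcD.
Qed.

End fourier_transform.

(** * Energies, the Fourier spectrum, and decay from the Hölder condition *)

Section energies.
Context {R : realType} {d : nat} (d_gt0 : (0 < d)%N).
Local Notation E := (euclid R d).
Implicit Types m : {measure set E -> \bar R}.

(** For [p = 2 / theta] and [q = s / theta - d] this is the part of the integral in [fourier_energy]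
    over norms at least 1, without the outer power [theta]. *)
Definition tail_energy m (p q : R) : \bar R :=
  (\int[lebesgue_tuple d]_z (fourier_abs m z `^ p * tail_weight q z)%:E)%E.

Lemma measurable_tail_energy_integrand m p q :
  measurable_fun setT (fourier_abs m) ->
  measurable_fun setT (fun z => fourier_abs m z `^ p * tail_weight q z).
Proof.
move=> mphi; apply: measurable_funM; last exact: measurable_tail_weight.
exact: (measurableT_comp (measurable_powR p) mphi).
Qed.

Lemma le_tail_energy m p : measurable_fun setT (fourier_abs m) ->
  {homo tail_energy m p : q q' / q <= q' >-> (q <= q')%E}.
Proof.
move=> mphi q q' qq'; apply: ge0_le_integral => //.
- by move=> z _; rewrite lee_fin mulr_ge0 ?powR_ge0 ?tail_weight_ge0.
- by apply/measurable_EFinP; exact: measurable_tail_energy_integrand.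
- by apply/measurable_EFinP; exact: measurable_tail_energy_integrand.
move=> z _; rewrite lee_fin ler_wpM2l ?powR_ge0// /tail_weight.
by case: ifPn => // z1; rewrite ler_powR.
Qed.

(** Finiteness is asked only below [s], since the energy at [s] may diverge: if the spectrum were
    some [r < s], the midpoint of [r] and [s] would be an admissible exponent above it. *)
Lemma fourier_spectrum_ge m (theta s : R) : 0 < s ->
  (forall t, 0 < t < s -> (fourier_energy t theta m < +oo)%E) ->
  (s%:E <= fourier_spectrum theta m)%E.
Proof.
move=> s0 Hs; rewrite leNgt; apply/negP => lts.
have : (0 <= fourier_spectrum theta m)%E by rewrite le_max lexx.
move: lts; case E : (fourier_spectrum theta m) => [r| |] //.
rewrite lte_fin lee_fin => rs r0.
suff : (((r + s) / 2)%:E <= r%:E)%E by rewrite lee_fin; lra.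
rewrite -E /fourier_spectrum le_max; apply/orP; right.
apply: ereal_sup_ubound; exists ((r + s) / 2) => //=; split; first lra.
by apply: Hs; lra.
Qed.

(** Inside the unit ball the transform is bounded by twice the mass, and the remaining power of the
    norm is integrable there because [t > 0] puts its exponent above [- d]. *)
Lemma fourier_energy_lty m (theta t : R) : 0 < theta -> 0 < t ->
  m setT \is a fin_num -> measurable_fun setT (fourier_abs m) ->
  (tail_energy m (2 / theta) (t / theta - d%:R) < +oo)%E ->
  (fourier_energy t theta m < +oo)%E.
Proof.
move=> theta0 t0 mfin mphi tail_lty.
rewrite /fourier_energy gt_eqF//; apply: poweR_lty.
set p := 2 / theta; set q := t / theta - d%:R.
have p0 : 0 <= p by rewrite divr_ge0// ltW.
have nq : - d%:R < q by rewrite ltrBrDl subrr divr_gt0.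
pose B := (2 * fine (m setT)) `^ p.
apply: (@le_lt_trans _ _ (\int[lebesgue_tuple d]_z
  ((fourier_abs m z `^ p * tail_weight q z)%:E + B%:E * core_weight q z))%E).
  apply: ge0_le_integral => //.
  - by move=> z _; rewrite mule_ge0 ?lee_fin ?powR_ge0 ?powRoo_ge0.
  - apply: emeasurable_funM.
      by apply/measurable_EFinP; exact: (measurableT_comp (measurable_powR p) mphi).
    under eq_fun do rewrite powRoo_split.
    apply: emeasurable_funD; last exact: measurable_core_weight.
    by apply/measurable_EFinP; exact: measurable_tail_weight.
  - apply: emeasurable_funD.
      by apply/measurable_EFinP; exact: measurable_tail_energy_integrand.
    by apply: measurable_funeM; exact: measurable_core_weight.
  move=> z _.
  rewrite powRoo_split ge0_muleDr ?lee_fin ?tail_weight_ge0//; last first.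
    exact: core_weight_ge0.
  rewrite -EFinM leeD2l// lee_wpmul2r ?core_weight_ge0// lee_fin.
  by rewrite (ge0_ler_powR p0) ?nnegrE ?fourier_abs_ge0 ?fourier_abs_le_mass//
    mulr_ge0 ?fine_ge0.
rewrite ge0_integralD//; last 4 first.
- by move=> z _; rewrite lee_fin mulr_ge0 ?powR_ge0 ?tail_weight_ge0.
- by apply/measurable_EFinP; exact: measurable_tail_energy_integrand.
- by move=> z _; rewrite mule_ge0 ?lee_fin ?powR_ge0 ?core_weight_ge0.
- by apply: measurable_funeM; exact: measurable_core_weight.
rewrite lte_add_pinfty// ge0_integralZl ?lee_fin ?powR_ge0//; last 2 first.
- exact: measurable_core_weight.
- by move=> z _; exact: core_weight_ge0.
by rewrite lte_mul_pinfty ?lee_fin ?powR_ge0// integral_core_weight_lty.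
Qed.

(* On the cube of side [h] with vertex [z] pointing away from the origin,
   [enorm >= enorm z]; choosing [h] proportional to [t ^ (1 / alpha)], where [t]
   is the value of [fourier_abs m] at [z], keeps [fourier_abs m >= t / 2] there. *)
Lemma holder_tail_decay m (alpha p q : R) : 0 < alpha -> 0 <= p -> 0 <= q ->
  measurable_fun setT (fourier_abs m) -> alpha_holder alpha (fourier m) ->
  (tail_energy m p q < +oo)%E ->
  exists2 K : R, 0 <= K & forall z, 1 <= enorm z ->
    fourier_abs m z `^ (p + d%:R / alpha) * enorm z `^ q <= K.
Proof.
move=> alpha0 p0 q0 mphi [C C0 holdC] tail_lty.
have dR0 : 0 < d%:R :> R by rewrite ltr0n.
set D := d%:R / alpha; have D0 : 0 < D by rewrite divr_gt0.
have tail_ge0 : (0 <= tail_energy m p q)%E.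
  by apply: integral_ge0 => z _; rewrite lee_fin mulr_ge0 ?powR_ge0 ?tail_weight_ge0.
have tail_fin : tail_energy m p q \is a fin_num by rewrite ge0_fin_numE.
set T := fine (tail_energy m p q).
have T0 : 0 <= T by rewrite fine_ge0.
(* The constant results from solving for [t] in the bound of the energy over the cube by [T], with
   the side [h] chosen below. *)
pose K := T * (2 `^ p * (2 * C) `^ D * d%:R ^+ d).
exists K; first by rewrite !mulr_ge0 ?powR_ge0 ?exprn_ge0.
move=> z z1; set t := fourier_abs m z.
have t_ge0 : 0 <= t := fourier_abs_ge0 m z.
(* The value 0 is set apart because splitting the power [p + D] of [t] at the end requires
   [t != 0]. *)
have [t0|t_neq0] := eqVneq t 0.
  rewrite t0 powR0 ?mul0r; last by rewrite gt_eqF// ltr_wpDl.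
  by rewrite !mulr_ge0 ?powR_ge0 ?exprn_ge0.
have t_gt0 : 0 < t by rewrite lt_def t_neq0.
(* Within distance [l] the Hölder condition allows a drop of at most [t / 2]; dividing by [d] keeps
   the whole cube within that distance, by [edist_le]. *)
pose l := (t / (2 * C)) `^ alpha^-1; pose h := l / d%:R.
have tC0 : 0 <= t / (2 * C) by rewrite divr_ge0// mulr_ge0// ltW.
have l0 : 0 <= l by rewrite powR_ge0.
have h0 : 0 <= h by rewrite divr_ge0// ltW.
have l_alpha : l `^ alpha = t / (2 * C).
  by rewrite /l -powRrM mulVf ?gt_eqF// powRr1.
pose a i : R := if 0 <= (tnth z i : R) then tnth z i else (tnth z i : R) - h.
have near_z x : cube a h x -> t / 2 <= fourier_abs m x.
  move=> xa; have zx i : `|(tnth z i : R) - (tnth x i : R)| <= h.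
    have := xa i; rewrite /a ler_norml.
    by case: ifP => _ /andP[u v]; apply/andP; split; lra.
  have zxl : Defs.edist z x <= l.
    by rewrite (le_trans (edist_le h0 zx))// /h mulrC divfK ?gt_eqF.
  have : t - fourier_abs m x <= C * (t / (2 * C)).
    apply: le_trans (fourier_absB_le m z x) _.
    apply: le_trans (holdC z x) _; rewrite (ler_wpM2l (ltW C0))// -l_alpha.
    by rewrite (ge0_ler_powR (ltW alpha0)) ?nnegrE ?sqrtr_ge0.
  rewrite (_ : C * (t / (2 * C)) = t / 2); last by field; rewrite gt_eqF.
  lra.
have outward x : cube a h x -> enorm z <= enorm x.
  move=> xa; apply: ler_enorm => i; have := xa i; rewrite /a.
  case: ifPn => [zi|]; last rewrite -ltNge => zi.
    by move=> /andP[u v]; rewrite !ger0_norm// (le_trans zi).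
  by move=> /andP[u v]; rewrite !ler0_norm; lra.
(* Restrict the energy to the cube: its points have norm at least [enorm z >= 1], so the tail weight
   does not vanish there and, as [q >= 0], is at least its value at [z]. *)
have : ((((t / 2) `^ p * enorm z `^ q) * h ^+ d)%:E <= tail_energy m p q)%E.
  have mcube := measurable_cube a h.
  have Icube : (\int[lebesgue_tuple d]_x (\1_(cube a h) x)%:E = (h ^+ d)%:E)%E.
    by rewrite integral_indic// setIT [LHS]lebesgue_cube.
  rewrite EFinM -Icube.
  rewrite -ge0_integralZl ?lee_fin ?mulr_ge0 ?powR_ge0//; last first.
    by apply/measurable_EFinP; apply: measurable_indic.
  apply: ge0_le_integral => //.
  - by move=> x _; rewrite mule_ge0 ?lee_fin ?mulr_ge0 ?powR_ge0.
  - by apply: measurable_funeM; apply/measurable_EFinP; apply: measurable_indic.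
  - by apply/measurable_EFinP; exact: measurable_tail_energy_integrand.
  move=> x _; rewrite -EFinM lee_fin indicE.
  case: (boolP (x \in cube a h)) => [/set_mem xa|_]; last first.
    by rewrite mulr0 mulr_ge0 ?powR_ge0 ?tail_weight_ge0.
  have zx := outward x xa; rewrite mulr1 /tail_weight (le_trans z1 zx).
  by rewrite ler_pM ?powR_ge0// ge0_ler_powR ?nnegrE ?enorm_ge0
    ?fourier_abs_ge0 ?near_z ?divr_ge0.
rewrite -(fineK tail_fin) lee_fin -/T => leT.
rewrite -(ler_pM2r (_ : 0 < (2 `^ p * (2 * C) `^ D * d%:R ^+ d)^-1)); last first.
  by rewrite invr_gt0 !mulr_gt0 ?powR_gt0 ?exprn_gt0 ?mulr_gt0.
rewrite /K mulfK; last by rewrite !mulf_neq0 ?gt_eqF ?powR_gt0 ?exprn_gt0 ?mulr_gt0.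
apply: le_trans leT; rewrite le_eqVlt; apply/orP; left; apply/eqP.
rewrite powRD; last by rewrite t_neq0 implybT.
(* The volume of the cube supplies the additional power [D = d / alpha] of [t]. *)
have -> : h ^+ d = t `^ D / ((2 * C) `^ D * d%:R ^+ d).
  rewrite /h expr_div_n -(powR_mulrn _ l0) /l -powRrM mulrC (mulrC alpha^-1) -/D.
  by rewrite powR_div ?mulr_ge0 ?ltW// invfM; ring.
by rewrite powR_div// !invfM; ring.
Qed.

(** Raising the decay bound to the power [2 / D], where [D = p + d / alpha], makes the exponent of
    the transform 2 and that of the norm [2 * q / D], which is at least [u]. *)
Lemma holder_fourier_energy_lty m (alpha p q u : R) :
  0 < alpha -> 0 <= p -> 0 <= q -> 0 <= u -> u * (p + d%:R / alpha) <= 2 * q ->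
  m setT \is a fin_num -> measurable_fun setT (fourier_abs m) ->
  alpha_holder alpha (fourier m) -> (tail_energy m p q < +oo)%E ->
  (fourier_energy u 0 m < +oo)%E.
Proof.
move=> alpha0 p0 q0 u0 + mfin mphi hold tail_lty.
have [K K0 decay] := holder_tail_decay alpha0 p0 q0 mphi hold tail_lty.
move: decay; set D := p + d%:R / alpha => decay uq.
have D0 : 0 < D by rewrite ltr_wpDl// divr_gt0// ltr0n.
(* The first summand covers norms below 1, the second all others. *)
pose B := (2 * fine (m setT)) ^+ 2 + K `^ (2 / D).
rewrite /fourier_energy eqxx; apply: (@le_lt_trans _ _ B%:E); last exact: ltry.
apply: ge_ereal_sup => _ [z _ <-].
rewrite /powRoo ltNge u0 andbF -EFinM lee_fin.
have [z1|z1] := leP 1 (enorm z); last first.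
  rewrite (@le_trans _ _ ((2 * fine (m setT)) ^+ 2))//; last first.
    by rewrite lerDl powR_ge0.
  rewrite -[leRHS]mulr1 ler_pM ?sqr_ge0 ?powR_ge0//.
    by rewrite ler_pXn2r ?nnegrE ?fourier_abs_ge0 ?fourier_abs_le_mass//
      mulr_ge0// fine_ge0.
  have pow1 : 1 `^ u = 1 :> R by rewrite powR1.
  by rewrite -[leRHS]pow1 (ge0_ler_powR u0) ?nnegrE ?enorm_ge0 ?ltW.
rewrite (@le_trans _ _ (K `^ (2 / D)))//; last by rewrite lerDr sqr_ge0.
apply: (@le_trans _ _ ((fourier_abs m z `^ D * enorm z `^ q) `^ (2 / D))); last first.
  have D2 : 0 <= 2 / D by rewrite divr_ge0// ltW.
  by rewrite (ge0_ler_powR D2) ?nnegrE ?mulr_ge0 ?powR_ge0 ?decay.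
rewrite powRM ?powR_ge0// -!powRrM (mulrC D) divfK ?gt_eqF//.
rewrite powR_mulrn ?fourier_abs_ge0// ler_wpM2l ?sqr_ge0//.
by rewrite ler_powR// mulrCA mulrA ler_pdivlMr.
Qed.

End energies.

(** * From moment bounds to almost surely finite tail energies *)

Section moments.
Context {R : realType} {d : nat} (d_gt0 : (0 < d)%N) (disp : measure_display)
  (Omega : measurableType disp) (P : probability Omega R)
  (mu : R.-ftker Omega ~> euclid R d).

Lemma kernel_mass_fin w : mu w setT \is a fin_num.
Proof. exact: kernel_finite_transition. Qed.

Lemma measurable_fourier_abs_kernel w : measurable_fun setT (fourier_abs (mu w)).
Proof.
apply: (@measurableT_comp _ _ _ _ _ _ _ _ (fun z => (w, z))
  (measurable_fourier_abs mu)).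
exact: measurable_fun_pair.
Qed.

(** By Tonelli the expected tail energy is at most [c] times the integral of the tail weight of
    exponent [q - r < - d], hence finite; a nonnegative variable of finite expectation is almost
    surely finite. *)
Lemma tail_energy_ae_lty_at (p r q : R) :
  lesssim (fun z : euclid R d => 'E_P[fun w => (fourier_abs (mu w) z `^ p)%R]%E)
    (fun z => powRoo (enorm z) (- r)) ->
  q < r - d%:R ->
  {ae P, forall w, (tail_energy (mu w) p q < +oo)%E}.
Proof.
move=> [c c0 Ec] qr.
pose F (t : Omega * euclid R d) : \bar R :=
  (fourier_abs (mu t.1) t.2 `^ p * tail_weight q t.2)%:E.
have F0 t : (0 <= F t)%E.
  by rewrite lee_fin mulr_ge0 ?powR_ge0 ?tail_weight_ge0.
have mphi : measurable_fun setT
    (fun t : Omega * euclid R d => fourier_abs (mu t.1) t.2 `^ p).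
  exact: (measurableT_comp (measurable_powR p) (measurable_fourier_abs mu)).
have mF : measurable_fun setT F.
  apply/measurable_EFinP; apply: measurable_funM => //.
  exact: (measurableT_comp (measurable_tail_weight q) measurable_snd).
have int_lty : (\int[P]_w \int[lebesgue_tuple d]_z F (w, z) < +oo)%E.
  rewrite (fubini_tonelli F mF F0)//.
  apply: (@le_lt_trans _ _
      (\int[lebesgue_tuple d]_z (c%:E * (tail_weight (q - r) z)%:E))%E).
    apply: ge0_le_integral => //.
    - by move=> z _; exact: integral_ge0.
    - exact: (measurable_fun_fubini_tonelli_G F mF F0).
    - apply: measurable_funeM; apply/measurable_EFinP.
      exact: measurable_tail_weight.
    move=> z _; rewrite /F /=.
    under eq_integral do rewrite EFinM.
    rewrite ge0_integralZr ?lee_fin ?tail_weight_ge0//; last 2 first.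
    - apply/measurable_EFinP.
      by apply: (@measurableT_comp _ _ _ _ _ _ _ _ (fun w => (w, z)) mphi).
    - by move=> w _; rewrite lee_fin powR_ge0.
    rewrite /tail_weight; case: ifPn => z1; last by rewrite !mule0.
    have z0 : 0 < enorm z by rewrite (lt_le_trans _ z1).
    have := Ec z; rewrite unlock powRoo_gt0// => Ez.
    rewrite addrC powRD; last by rewrite (gt_eqF z0) implybT.
    by rewrite EFinM muleA lee_wpmul2r ?lee_fin ?powR_ge0.
  rewrite ge0_integralZl ?lee_fin//; last 3 first.
  - by apply/measurable_EFinP; exact: measurable_tail_weight.
  - by move=> z _; rewrite lee_fin tail_weight_ge0.
  - exact: ltW.
  rewrite lte_mul_pinfty ?lee_fin ?ltW// integral_tail_weight_lty//.
  by rewrite ltrBlDr addrC.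
have : P.-integrable setT (fun w => \int[lebesgue_tuple d]_z F (w, z))%E.
  apply/integrableP; split.
    exact: (measurable_fun_fubini_tonelli_F F mF F0).
  rewrite (eq_integral (fun w => \int[lebesgue_tuple d]_z F (w, z)))%E//.
  by move=> w _; rewrite gee0_abs// integral_ge0.
move=> /(integrable_ae measurableT); apply: filterS => w /(_ I).
by rewrite ge0_fin_numE// integral_ge0.
Qed.

(** One null set has to serve all [q], since later [q] is chosen after the sample point. The
    countably many exponents [r - d - 1 / (n + 1)] suffice because the tail energy is monotone in
    [q]. *)
Lemma tail_energy_ae_lty (p r : R) :
  lesssim (fun z : euclid R d => 'E_P[fun w => (fourier_abs (mu w) z `^ p)%R]%E)
    (fun z => powRoo (enorm z) (- r)) ->
  {ae P, forall w, forall q, q < r - d%:R -> (tail_energy (mu w) p q < +oo)%E}.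
Proof.
move=> H.
have : {ae P, forall w, forall n : nat,
    (tail_energy (mu w) p (r - d%:R - n.+1%:R^-1) < +oo)%E}.
  apply: ae_foralln => n; apply: (tail_energy_ae_lty_at H).
  by rewrite ltrBlDr ltrDl invr_gt0.
apply: filterS => w Hw q qr.
have [n qn] : exists n : nat, n.+1%:R^-1 < r - d%:R - q.
  have rq : 0 < r - d%:R - q by rewrite subr_gt0.
  by have [n _ /(_ n (leqnn n))] := near_infty_natSinv_lt (PosNum rq); exists n.
apply: le_lt_trans (Hw n).
apply: le_tail_energy; first exact: measurable_fourier_abs_kernel.
by rewrite lerBrDl -lerBrDr ltW.
Qed.

End moments.

(** * The three almost sure lower bounds *)

Theorem lemma8p1 (R : realType) (d : nat) (d_gt0 : (0 < d)%N)
    (disp : measure_display) (Omega : measurableType disp)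
    (P : probability Omega R) (mu : R.-ftker Omega ~> euclid R d) :
  (forall theta s : R, 0 < theta <= 1 -> 0 < s ->
    lesssim
      (fun z : euclid R d =>
         'E_P[fun w => (fourier_abs (mu w) z `^ (2 / theta))%R]%E)
      (fun z => powRoo (enorm z) (- (s / theta))) ->
    {ae P, forall w, (s%:E <= fourier_spectrum theta (mu w))%E})
  /\
  (forall s : R, 0 < s ->
    {ae P, forall w, is_holder (fourier (mu w))} ->
    forall k : nat -> nat, k n @[n --> \oo] --> \oo ->
    (forall n : nat,
      lesssim
        (fun z : euclid R d =>
           'E_P[fun w => (fourier_abs (mu w) z ^+ (2 * k n))%R]%E)
        (fun z => powRoo (enorm z) (- (s * (k n)%:R)))) ->
    {ae P, forall w, (s%:E <= fourier_dim (mu w))%E})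
  /\
  (forall alpha epsilon theta : R,
    0 < alpha <= 1 -> 0 < epsilon -> 0 < theta < 1 ->
    {ae P, forall w, alpha_holder alpha (fourier (mu w))} ->
    lesssim
      (fun z : euclid R d =>
         'E_P[fun w => (fourier_abs (mu w) z `^ (2 / theta))%R]%E)
      (fun z => powRoo (enorm z) (- (d%:R + epsilon))) ->
    {ae P, forall w,
      ((2 * alpha * epsilon * theta / (2 * alpha + d%:R * theta))%:E
        <= fourier_dim (mu w))%E}
    /\ 0 < 2 * alpha * epsilon * theta / (2 * alpha + d%:R * theta)).
Proof.
split=> [theta s /andP[theta0 _] s0 moment|].
  have := tail_energy_ae_lty d_gt0 moment; apply: filterS => w tail_lty.
  apply: fourier_spectrum_ge => // t /andP[t0 ts].
  apply: fourier_energy_lty => //.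
  - exact: kernel_mass_fin.
  - exact: measurable_fourier_abs_kernel.
  by apply: tail_lty; rewrite ltrD2r ltr_pM2r ?invr_gt0.
split=> [s s0 hold k k_oo moment|
  alpha eps theta /andP[alpha0 _] eps0 /andP[theta0 _] hold moment].
  (* The countably many moment conditions share one null set, so [n] may afterwards depend on the
     random Hölder exponent. *)
  have tails : {ae P, forall w, forall n q, q < s * (k n)%:R - d%:R ->
      (tail_energy (mu w) (2 * k n)%:R q < +oo)%E}.
    apply: ae_foralln => n; apply: tail_energy_ae_lty => //.
    have [c c0 mn] := moment n; exists c => // z; apply: le_trans (mn z).
    rewrite le_eqVlt; apply/orP; left; apply/eqP; congr expectation.
    by apply/funext => w; rewrite powR_mulrn// fourier_abs_ge0.
  move: hold tails; apply: filterS2 => w [alpha /andP[alpha0 _] hold] tails.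
  apply: fourier_spectrum_ge => // u /andP[u0 us].
  have D0 : 0 <= d%:R / alpha :> R by rewrite divr_ge0// ltW.
  (* Room is needed on both sides of [t]: [t < s] makes the tail energy with [q = t * k n - d]
     finite, and [u < t] lets a large [k n] absorb the loss from [d] and [d / alpha]. *)
  pose t := (u + s) / 2.
  have ut : 0 < t - u by rewrite /t; lra.
  (* This threshold yields both [q >= 0] and [u * (2 * k n + d / alpha) <= 2 * q]. *)
  have [n kn] : exists n, (d%:R + u * (d%:R / alpha)) / (t - u) <= (k n)%:R.
    set x := _ / (t - u); have [N _ kN] := k_oo _ (nbhs_infty_ge (Num.truncn x).+1).
    exists N; rewrite (le_trans (ltW (truncnS_gt x)))// ler_nat.
    exact: (kN N (leqnn N)).
  rewrite ler_pdivrMr// in kn.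
  have uD : 0 <= u * (d%:R / alpha) by rewrite mulr_ge0// ltW.
  have k0 : 0 < (k n)%:R :> R.
    rewrite -(pmulr_lgt0 _ ut); apply: lt_le_trans kn.
    by rewrite (ltr_wpDr uD) ?ltr0n.
  have uk : 0 <= u * (k n)%:R by rewrite mulr_ge0// ltW.
  apply: (@holder_fourier_energy_lty _ _ d_gt0 _ alpha (2 * k n)%:R
    (t * (k n)%:R - d%:R)) => //.
  - lra.
  - exact: ltW.
  - rewrite natrM; lra.
  - exact: kernel_mass_fin.
  - exact: measurable_fourier_abs_kernel.
  apply: tails; rewrite ltrD2r ltr_pM2r// /t; lra.
have den0 : 0 < 2 * alpha + d%:R * theta by rewrite addr_gt0 ?mulr_gt0 ?ltr0n.
set bound := 2 * alpha * eps * theta / _.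
have bound0 : 0 < bound by rewrite divr_gt0 ?mulr_gt0.
split=> //; have := tail_energy_ae_lty d_gt0 moment.
move: hold; apply: filterS2 => w hold tail_lty.
apply: fourier_spectrum_ge => // u /andP[u0 ub].
(* This [q] turns the condition [u * (p + d / alpha) <= 2 * q] into an equality for
   [p = 2 / theta]. *)
pose q := u * (2 / theta + d%:R / alpha) / 2.
have D0 : 0 < 2 / theta + d%:R / alpha by rewrite addr_gt0 ?divr_gt0 ?ltr0n.
apply: (@holder_fourier_energy_lty _ _ d_gt0 _ alpha (2 / theta) q) => //.
- by rewrite divr_ge0// ltW.
- by rewrite divr_ge0// mulr_ge0// ltW.
- exact: ltW.
- by rewrite /q [leRHS]mulrC divfK.
- exact: kernel_mass_fin.
- exact: measurable_fourier_abs_kernel.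
apply: tail_lty; rewrite addrC addKr.
(* The stated bound is exactly the [u] at which [q] reaches [eps], so [u < bound] gives
   [q < eps]. *)
have -> : eps = bound * (2 / theta + d%:R / alpha) / 2.
  by rewrite /bound; field; rewrite !gt_eqF.
by rewrite ltr_pM2r ?invr_gt0// ltr_pM2r.
Qed.
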